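(* Let $\mathcal{H}$ be a Hilbert $C^*$-module over a unital $C^*$-algebra $\mathcal{A}$ and let $\{\mathcal{H}_j\}_{j\in J}$ be a family of closed submodules of $\mathcal{H}$. Assume that $\{\Lambda_j\in End_{\mathcal{A}}^*(\mathcal{H},\mathcal{H}_j):j\in J\}$ is a g-frame for $\mathcal{H}$ with respect to $\{\mathcal{H}_j\}_{j\in J}$. Let $C,C'\in GL^+(\mathcal{H})$ commute with each other and with $\Lambda_j^*\Lambda_j$ for each $j\in J$. Then $\{\Lambda_j:j\in J\}$ is a $(C,C')$-controlled g-frame for $\mathcal{H}$ with respect to $\{\mathcal{H}_j\}_{j\in J}$.
   Context: $\mathcal{A}$ is a unital $C^*$-algebra, and $\mathcal{H}$ is a (left) Hilbert $\mathcal{A}$-module with $\mathcal{A}$-valued inner product $\langle\cdot,\cdot\rangle$ ($\mathcal{A}$-linear in the first variable) and norm $\|f\|=\|\langle f,f\rangle\|^{1/2}$. $J$ is any index set. $End_{\mathcal{A}}^*(\mathcal{H},\mathcal{H}_j)$ is the set of adjointable $\mathcal{A}$-linear operators $\mathcal{H}\to\mathcal{H}_j$. $GL^+(\mathcal{H})$ is the set of all positive bounded linear invertible operators on $\mathcal{H}$ with bounded inverse. A family $\{\Lambda_j\in End_{\mathcal{A}}^*(\mathcal{H},\mathcal{H}_j):j\in J\}$ is a g-frame for $\mathcal{H}$ with respect to $\{\mathcal{H}_j\}_{j\in J}$ if there exist positive constants $A,B$ such that $A\langle f,f\rangle\le\sum_{j\in J}\langle\Lambda_jf,\Lambda_jf\rangle\le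 B\langle f,f\rangle$ for all $f\in\mathcal{H}$. For $C,C'\in GL^+(\mathcal{H})$, it is a $(C,C')$-controlled g-frame for $\mathcal{H}$ with respect to $\{\mathcal{H}_j\}_{j\in J}$ if there exist constants $0<A\le B<\infty$ such that $A\langle f,f\rangle\le\sum_{j\in J}\langle\Lambda_jCf,\Lambda_jC'f\rangle\le B\langle f,f\rangle$ for all $f\in\mathcal{H}$. *)

(* Defs.v *)
From HB Require Import structures.
From mathcomp Require Import all_boot all_order all_algebra finmap.
From mathcomp Require Import all_classical all_reals all_analysis.
From mathcomp.real_closed Require Import complex.

Set Implicit Arguments.
Unset Strict Implicit.
Unset Printing Implicit Defensive.

Import Order.TTheory GRing.Theory Num.Def Num.Theory.

Local Open Scope classical_set_scope.
Local Open Scope ring_scope.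
Local Open Scope complex_scope.

(* Unital C*-algebras. The product is part of the mixin, and the ring structure
   is derived from it below, because Hierarchy Builder does not accept a join
   of the ring and normed module structures. The zero algebra is allowed. *)
HB.mixin Record isCStarAlgebra (R : realType) A
    & CompleteNormedModule R[i] A := {
  cmul : A -> A -> A;
  cone : A;
  star : A -> A;
  cmulA : associative cmul;
  cmul1l : left_id cone cmul;
  cmul1r : right_id cone cmul;
  cmulDl : left_distributive cmul +%R;
  cmulDr : right_distributive cmul +%R;
  cscaleAl : forall (z : R[i]) (a b : A), z *: cmul a b = cmul (z *: a) b;
  cscaleAr : forall (z : R[i]) (a b : A), z *: cmul a b = cmul a (z *: b);
  starK : involutive star;
  starD : forall a b : A, star (a + b) = star a + star b;
  starZ : forall (z : R[i]) (a : A), star (z *: a) = Num.conj z *: star a;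
  star_cmul : forall a b : A, star (cmul a b) = cmul (star b) (star a);
  norm_cmul_le : forall a b : A, `|cmul a b| <= `|a| * `|b|;
  cstar_identity : forall a : A, `|cmul (star a) a| = `|a| ^+ 2;
}.

#[short(type="cstarAlgType")]
HB.structure Definition CStarAlgebra (R : realType) :=
  {A of CompleteNormedModule R[i] A & isCStarAlgebra R A}.

Section CStarRing.
Variables (R : realType) (A : cstarAlgType R).

#[non_forgetful_inheritance]
HB.instance Definition _ := GRing.Zmodule_isPzRing.Build A
  (@cmulA R A) (@cmul1l R A) (@cmul1r R A) (@cmulDl R A) (@cmulDr R A).

End CStarRing.

Section CStarOrder.
Variables (R : realType) (A : cstarAlgType R).
Implicit Types a b : A.

Definition invertible a := exists b, a * b = 1 /\ b * a = 1.

Definition spectrum a : set R[i] := [set z : R[i] | ~ invertible (a - z *: (1 : A))].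

(* In R[i], 0 <= z means that z is real and nonnegative. *)
Definition cpos a := star a = a /\ forall z, spectrum a z -> 0 <= z.

Definition cle a b := cpos (b - a).

End CStarOrder.

Notation "a <=* b" := (cle a b) (at level 70, no associativity) : ring_scope.

HB.mixin Record isHilbertModule (R : realType) (A : cstarAlgType R) H
    & CompleteNormedModule R[i] H := {
  act : A -> H -> H;
  ip : H -> H -> A;
  actDl : forall (a b : A) (f : H), act (a + b) f = act a f + act b f;
  actDr : forall (a : A) (f g : H), act a (f + g) = act a f + act a g;
  actM : forall (a b : A) (f : H), act (a * b) f = act a (act b f);
  act1 : forall f : H, act 1 f = f;
  actZ : forall (z : R[i]) (a : A) (f : H), act (z *: a) f = z *: act a f;
  ipDl : forall f g h : H, ip (f + g) h = ip f h + ip g h;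
  ip_act : forall (a : A) (f g : H), ip (act a f) g = a * ip f g;
  ip_star : forall f g : H, ip g f = star (ip f g);
  ip_ge0 : forall f : H, cpos (ip f f);
  ip_eq0 : forall f : H, ip f f = 0 -> f = 0;
  norm_ipE : forall f : H, `|f| = sqrtC `|ip f f|;
}.

#[short(type="hilbertModType")]
HB.structure Definition HilbertModule (R : realType) (A : cstarAlgType R) :=
  {H of CompleteNormedModule R[i] H & isHilbertModule R A H}.

Section Operators.
Variables (R : realType) (A : cstarAlgType R).

(* End*_A(E, F). The adjoint is uniquely determined by adjP. *)
Record adjointable (E F : hilbertModType A) := Adjointable {
  adj_op :> {linear E -> F};
  adj_op_act : forall (a : A) (x : E), adj_op (act a x) = act a (adj_op x);
  adjoint : F -> E;
  adjP : forall (x : E) (y : F), ip (adj_op x) y = ip x (adjoint y);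
}.

Definition bounded_op (E F : hilbertModType A) (T : E -> F) :=
  exists M : R, forall x : E, `|T x| <= M%:C * `|x|.

Definition positive_op (E : hilbertModType A) (T : E -> E) :=
  forall x : E, cpos (ip (T x) x).

(* A-linearity need not be required: a complex linear T such that every
   ip (T x) x is positive is self-adjoint by polarization. *)
Definition GLplus (E : hilbertModType A) : set {linear E -> E} :=
  [set T | [/\ positive_op T, bounded_op T &
    exists T' : E -> E, [/\ cancel T T', cancel T' T & bounded_op T']]].

End Operators.

Section ClosedSubmodule.
Variables (R : realType) (A : cstarAlgType R) (H : hilbertModType A).

Record closedSubmod := ClosedSubmod {
  csub_set :> set H;
  csub0 : csub_set 0;
  csubD : forall f g : H, csub_set f -> csub_set g -> csub_set (f + g);
  csub_act : forall (a : A) (f : H), csub_set f -> csub_set (act a f);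
  csub_closed : closed csub_set;
}.

Definition csub_pred (S : closedSubmod) : {pred H} :=
  fun f => f \in csub_set S.

Lemma csub_pred_submod (S : closedSubmod) : submod_closed (csub_pred S).
Proof.
split=> [|z f g]; first exact/mem_set/csub0.
move=> /set_mem Sf /set_mem Sg; apply/mem_set/csubD => //.
by rewrite -(act1 f) -actZ; exact: csub_act.
Qed.

HB.instance Definition _ (S : closedSubmod) :=
  GRing.isSubmodClosed.Build R[i] H (csub_pred S) (csub_pred_submod S).

Record submod (S : closedSubmod) :=
  Submod { incl :> H; inclP : incl \in csub_pred S }.

HB.instance Definition _ (S : closedSubmod) := [isSub for @incl S].
HB.instance Definition _ (S : closedSubmod) := [Choice of submod S by <:].
HB.instance Definition _ (S : closedSubmod) :=
  [SubChoice_isSubLmodule of submod S by <:].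

End ClosedSubmodule.

Section SubHilbert.
Variables (R : realType) (A : cstarAlgType R) (H : hilbertModType A).
Variable S : closedSubmod H.

Let nrm (f : submod S) : R[i] := `|incl f|.

Let nrmD f g : nrm (f + g) <= nrm f + nrm g. Proof. exact: ler_normD. Qed.

Let nrmZ z f : nrm (z *: f) = `|z| * nrm f. Proof. exact: normrZ. Qed.

Let nrm0 f : nrm f = 0 -> f = 0.
Proof. by move/eqP; rewrite normr_eq0 => /eqP f0; exact: val_inj. Qed.

HB.instance Definition _ := Lmodule_isNormed.Build R[i] (submod S) nrmD nrmZ nrm0.

Let ballE (f : submod S) (e : R[i]) : ball f e = [set g : submod S | ball (incl f) e (incl g)].
Proof. by rewrite -!ball_normE. Qed.

Let complete (F : set_system (submod S)) : ProperFilter F -> cauchy F -> cvg F.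
Proof.
move=> FF /cauchyP cF.
have : cauchy ((@incl R A H S) @ F).
  apply/cauchy_exP => e /cF [f Ff]; exists (incl f).
  by rewrite ballE in Ff.
move/cauchy_cvg/cvg_ex => [l Fl].
have Sl : csub_set S l.
  have := @closed_cvg _ H F _ (@incl R A H S) (csub_set S) (@csub_closed _ _ _ S).
  apply; last exact: Fl.
  by apply: nearW => f; exact/set_mem/inclP.
apply/cvg_ex; exists (Submod (mem_set Sl)); apply/fcvg_ballP => e e0.
by rewrite ballE; move/fcvg_ballP : Fl; exact.
Qed.

HB.instance Definition _ := Uniform_isComplete.Build (submod S) complete.

Let sact_subproof (a : A) (f : submod S) : act a (incl f) \in csub_pred S.
Proof. exact/mem_set/csub_act/set_mem/inclP. Qed.

Definition sact (a : A) (f : submod S) : submod S := Submod (sact_subproof a f).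

Definition sip (f g : submod S) : A := ip (incl f) (incl g).

Let sactDl a b f : sact (a + b) f = sact a f + sact b f.
Proof. by apply: val_inj; exact: actDl. Qed.

Let sactDr a f g : sact a (f + g) = sact a f + sact a g.
Proof. by apply: val_inj; exact: actDr. Qed.

Let sactM a b f : sact (a * b) f = sact a (sact b f).
Proof. by apply: val_inj; exact: actM. Qed.

Let sact1 f : sact 1 f = f.
Proof. by apply: val_inj; exact: act1. Qed.

Let sactZ z a f : sact (z *: a) f = z *: sact a f.
Proof. by apply: val_inj; exact: actZ. Qed.

Let sipDl f g h : sip (f + g) h = sip f h + sip g h.
Proof. exact: ipDl. Qed.

Let sip_act a f g : sip (sact a f) g = a * sip f g.
Proof. exact: ip_act. Qed.

Let sip_star f g : sip g f = star (sip f g).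
Proof. exact: ip_star. Qed.

Let sip_ge0 f : cpos (sip f f).
Proof. exact: ip_ge0. Qed.

Let sip_eq0 f : sip f f = 0 -> f = 0.
Proof. by move/ip_eq0 => f0; exact: val_inj. Qed.

Let snorm_ipE (f : submod S) : `|f| = sqrtC `|sip f f|.
Proof. exact: (norm_ipE (incl f)). Qed.

HB.instance Definition _ := isHilbertModule.Build R A (submod S)
  sactDl sactDr sactM sact1 sactZ sipDl sip_act sip_star sip_ge0 sip_eq0
  snorm_ipE.

End SubHilbert.

(* Convergence along the net of finite subsets of J, ordered by inclusion. *)
Definition finite_subsets (J : choiceType) : set_system {fset J} :=
  filter_from setT (fun D => [set E | fsubset D E]).

#[global] Instance finite_subsets_filter (J : choiceType) :
  ProperFilter (@finite_subsets J).
Proof.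
apply: filter_from_proper => [|D _]; last by exists D; exact: fsubset_refl.
apply: filter_from_filter => [|D E _ _]; first by exists fset0.
by exists (fsetU D E) => // X; rewrite /= fsubUset => /andP.
Qed.

Definition has_sum (R : realType) (A : cstarAlgType R) (J : choiceType)
    (u : J -> A) (s : A) :=
  (fun D : {fset J} => \sum_(j <- D) u j) @ @finite_subsets J --> s.

Section GFrames.
Variables (R : realType) (A : cstarAlgType R) (H : hilbertModType A).
Variables (J : choiceType) (K : J -> hilbertModType A).
Variable L : forall j, adjointable H (K j).

Definition is_gframe := exists a b : R, [/\ 0 < a, 0 < b &
  forall f : H, exists s : A,
    [/\ has_sum (fun j => ip (L j f) (L j f)) s,
        a%:C *: ip f f <=* s & s <=* b%:C *: ip f f]].

Definition is_controlled_gframe (C C' : H -> H) :=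
  exists a b : R, [/\ 0 < a, a <= b &
  forall f : H, exists s : A,
    [/\ has_sum (fun j => ip (L j (C f)) (L j (C' f))) s,
        a%:C *: ip f f <=* s & s <=* b%:C *: ip f f]].

End GFrames.

(* Main.v *)
Require Import Defs.
From mathcomp Require Import all_boot all_order all_algebra finmap.
From mathcomp Require Import all_classical all_reals all_analysis.
From mathcomp.real_closed Require Import complex.
From mathcomp Require Import ring lra.

(* For positive invertible [C] the operator [1 - C/k] has norm less than 1 for
   large [k], so [C = E^2] with [E] self-adjoint, a limit of polynomials in [C].
   Hence [E] commutes with whatever commutes with [C], and with [D = E E'], where
   [E'] is the root of [C'], each term of the controlled sum at [f] equals
   [<L_j D f, L_j D f>]. The frame inequalities at [D f] and the bounds
   [m <f, f> <= <D f, D f> <= M <f, f>] give the claim. As positivity in the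
   algebra is defined by the spectrum, that positive elements form a cone on which
   the norm is monotone rests on the spectral radius formula for self-adjoint
   elements, which is obtained from Rickart's argument. *)

Set Implicit Arguments.
Unset Strict Implicit.
Unset Printing Implicit Defensive.

Import Order.TTheory GRing.Theory Num.Def Num.Theory.
Import numFieldNormedType.Exports.

Local Open Scope classical_set_scope.
Local Open Scope ring_scope.
Local Open Scope complex_scope.

Local Notation Re := complex.Re.
Local Notation Im := complex.Im.

(** * Real-valued norms and geometric convergence *)

Section RealNorm.
Variable R : realType.

(** Norms take values in [R[i]]; their real part is open to [lra] and [nra]. *)
Definition nrm (V : normedZmodType R[i]) (v : V) : R := Re `|v|.

Section Zmod.
Variable V : normedZmodType R[i].
Implicit Types u v w : V.

Lemma normE v : `|v| = (nrm v)%:C.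
Proof. by rewrite /nrm RRe_real // ger0_real. Qed.

Lemma nrm_ge0 v : 0 <= nrm v.
Proof. by rewrite -ler0c -normE. Qed.

Lemma nrm0 : nrm (0 : V) = 0.
Proof. by rewrite /nrm normr0. Qed.

Lemma nrm_eq0 v : nrm v = 0 -> v = 0.
Proof. by move=> v0; apply/normr0_eq0; rewrite normE v0. Qed.

Lemma nrm_gt0 v : v <> 0 -> 0 < nrm v.
Proof.
by move=> v0; rewrite lt_def nrm_ge0 andbT; apply/eqP => /nrm_eq0.
Qed.

Lemma nrmD u v : nrm (u + v) <= nrm u + nrm v.
Proof. by rewrite -lecR rmorphD /= -!normE ler_normD. Qed.

Lemma nrmN v : nrm (- v) = nrm v.
Proof. by rewrite /nrm normrN. Qed.

Lemma nrmB u v : nrm (u - v) <= nrm u + nrm v.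
Proof. by rewrite -(nrmN v) nrmD. Qed.

Lemma nrmBC u v : nrm (u - v) = nrm (v - u).
Proof. by rewrite -nrmN opprB. Qed.

Lemma nrm_triangle w u v : nrm (u - v) <= nrm (u - w) + nrm (w - v).
Proof. by rewrite -[u - v](subrKA w) nrmD. Qed.

End Zmod.

Lemma nrmZ (V : normedModType R[i]) (z : R[i]) (v : V) :
  nrm (z *: v) = nrm z * nrm v.
Proof. by apply: complexI; rewrite rmorphM /= -!normE normrZ. Qed.

Lemma nrmM (z w : R[i]) : nrm (z * w) = nrm z * nrm w.
Proof. by apply: complexI; rewrite rmorphM /= -!normE normrM. Qed.

Lemma nrmC (r : R) : nrm r%:C = `|r|.
Proof. by rewrite /nrm normc_def /= expr0n addr0 sqrtr_sqr. Qed.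

Lemma geometric_le0 (x c q : R) : 0 <= q -> q < 1 ->
  (forall n, x <= c * q ^+ n) -> x <= 0.
Proof.
move=> q0 q1 xle.
have h : (fun n => c * q ^+ n) @ \oo --> c * 0.
  by apply: cvgMr; apply: cvg_expr; rewrite ger0_norm.
rewrite -(mulr0 c) -(cvg_lim _ h)//.
by apply: limr_ge; [exact: cvgP h | exact: nearW].
Qed.

Section Geometric.
Variables (V : completeNormedModType R[i]) (u : nat -> V) (c q : R).
Hypotheses (q0 : 0 <= q) (q1 : q < 1).
Hypothesis step : forall n, nrm (u n.+1 - u n) <= c * q ^+ n.

Let dist n m : nrm (u n - u (n + m)%N) <= c * q ^+ n / (1 - q).
Proof.
have c0 : 0 <= c by rewrite -[c]mulr1 -(expr0 q) (le_trans (nrm_ge0 _) (step 0)).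
elim: m n => [|m IH] n.
  rewrite addn0 subrr nrm0 divr_ge0 ?subr_ge0 ?(ltW q1)//.
  by rewrite mulr_ge0 ?exprn_ge0.
rewrite -addSnnS (le_trans (nrm_triangle (u n.+1) _ _))// nrmBC.
rewrite (le_trans (lerD (step n) (IH n.+1)))// exprS.
have -> // : c * q ^+ n + c * (q * q ^+ n) / (1 - q) = c * q ^+ n / (1 - q).
by field; rewrite subr_eq0 gt_eqF.
Qed.

(** The steps sum to a geometric tail, so the sequence is Cauchy. The rate is kept because
    identities between limits are proved later by bounding a difference by [c q^n] for every [n]. *)
Lemma geometric_cvg :
  exists l, forall n, nrm (u n - l) <= c * q ^+ n / (1 - q).
Proof.
have /cauchy_cvg/cvg_ex[l ul] : cauchy (u @ \oo).
  apply/cauchy_exP => e e0.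
  have eR : e = (Re e)%:C by rewrite RRe_real // gtr0_real.
  have [n ltn] : exists n, c * q ^+ n / (1 - q) < Re e.
    apply: contrapT => /forallNP h.
    have e0' : 0 < Re e by rewrite -ltcR -eR.
    suff : Re e <= 0 by lra.
    apply: (@geometric_le0 _ (c / (1 - q)) q) => // n.
    by rewrite mulrAC leNgt; apply/negP/h.
  exists (u n); exists n => // k /= /subnKC <-.
  by rewrite -ball_normE /= normE eR ltcR (le_lt_trans (dist _ _)).
exists l => n; apply/ler_addgt0Pr => e e0.
have /cvgrPdist_lt/(_ e%:C) := ul; rewrite ltcR => /(_ e0)[m _ um].
have /= := um (n + m)%N (leq_addl _ _); rewrite normE ltcR => /ltW ltl.
rewrite (le_trans (nrm_triangle (u (n + m)%N) _ _))// lerD//.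
by rewrite nrmBC.
Qed.

End Geometric.

Lemma nrm_geometric0 (V : normedZmodType R[i]) (v : V) (c q : R) :
  0 <= q -> q < 1 -> (forall n, nrm v <= c * q ^+ n) -> v = 0.
Proof.
move=> q0 q1 vle; apply/nrm_eq0/le_anti.
by rewrite nrm_ge0 andbT (geometric_le0 q0 q1 vle).
Qed.

End RealNorm.

(** * Inverses and the Neumann series in a C*-algebra *)

Section CStar.
Variables (R : realType) (A : cstarAlgType R).
Implicit Types (a b x y : A) (z w : R[i]) (r t : R).

Definition is_inv x y := x * y = 1 /\ y * x = 1.

Lemma scaleAl z a b : z *: (a * b) = (z *: a) * b.
Proof. exact: cscaleAl. Qed.

Lemma scaleAr z a b : z *: (a * b) = a * (z *: b).
Proof. exact: cscaleAr. Qed.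

Lemma starM a b : star (a * b) = star b * star a.
Proof. exact: star_cmul. Qed.

Lemma star1 : star (1 : A) = 1.
Proof. by rewrite -[LHS]mulr1 -{2}(starK 1) -starM mulr1 starK. Qed.

Lemma star0 : star (0 : A) = 0.
Proof. by apply: (addrI (star 0)); rewrite -starD !addr0. Qed.

Lemma starN a : star (- a) = - star a.
Proof. by apply: (addrI (star a)); rewrite -starD !subrr star0. Qed.

Lemma starB a b : star (a - b) = star a - star b.
Proof. by rewrite starD starN. Qed.

Lemma starZr r a : star (r%:C *: a) = r%:C *: star a.
Proof. by rewrite starZ conj_Creal// complex_real. Qed.

Lemma nrm_mul a b : nrm (a * b) <= nrm a * nrm b.
Proof. by rewrite -lecR rmorphM /= -!normE norm_cmul_le. Qed.

Lemma nrm_cstar a : nrm (star a * a) = nrm a ^+ 2.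
Proof. by apply: complexI; rewrite rmorphXn /= -!normE cstar_identity. Qed.

Lemma nrm_sqr_sa a : star a = a -> nrm (a * a) = nrm a ^+ 2.
Proof. by move=> sa; rewrite -nrm_cstar sa. Qed.

(** The C*-identity gives [|1| = |1|^2]; the value 0 occurs in the zero algebra. *)
Lemma nrm_one : nrm (1 : A) <= 1.
Proof.
have /esym := nrm_cstar 1; rewrite star1 mul1r.
have := nrm_ge0 (1 : A); nra.
Qed.

(** The inverse is the sum [y] of the geometric series in [x], with partial sums [u n]. In the limit
    [y = 1 + x y] and [y x = x y], which makes [y] the inverse; the bound follows from
    [|y| <= 1 + |x| |y|]. *)
Lemma neumann x : nrm x < 1 ->
  exists y, is_inv (1 - x) y /\ nrm y <= (1 - nrm x)^-1.
Proof.
move=> x1; pose u := fix u n : A := if n is n'.+1 then 1 + x * u n' else 0.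
have step n : nrm (u n.+1 - u n) <= 1 * nrm x ^+ n.
  rewrite mul1r; elim: n => [|n IH]; first by rewrite /= mulr0 addr0 subr0 nrm_one.
  have -> : u n.+2 - u n.+1 = x * (u n.+1 - u n).
    by rewrite mulrBr /= opprD addrACA subrr add0r.
  by rewrite (le_trans (nrm_mul _ _))// exprS ler_wpM2l ?nrm_ge0.
have comm n : u n * x = x * u n.
  elim: n => [|n IH]; first by rewrite /= mulr0 mul0r.
  by rewrite /= mulrDl mulrDr mul1r mulr1 -mulrA IH.
have [y uy] := geometric_cvg (nrm_ge0 x) x1 step.
set k := nrm x in x1 uy step *; have k0 : 0 <= k := nrm_ge0 x.
have small c n : c * (1 * k ^+ n / (1 - k)) = c / (1 - k) * k ^+ n.
  by field; rewrite subr_eq0 gt_eqF.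
have yE : y - (1 + x * y) = 0.
  apply: (@nrm_geometric0 _ _ _ (2 / (1 - k)) k) => // n.
  rewrite -small; apply: le_trans (nrm_triangle (u n.+1) _ _) _.
  rewrite nrmBC mulr_natl mulr2n lerD//.
    rewrite (le_trans (uy n.+1))// ler_wpM2r ?invr_ge0 ?subr_ge0 ?(ltW x1)//.
    by rewrite !mul1r exprS ler_piMl ?exprn_ge0// ltW.
  rewrite /= opprD addrACA subrr add0r -mulrBr (le_trans (nrm_mul _ _))//.
  rewrite -[leRHS]mul1r ler_pM ?nrm_ge0 ?uy//; exact: ltW.
have xy : y * x = x * y.
  apply/subr0_eq/(@nrm_geometric0 _ _ _ (2 / (1 - k)) k) => // n.
  rewrite -small; apply: le_trans (nrm_triangle (u n * x) _ _) _.
  rewrite mulr_natl mulr2n lerD//.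
    rewrite -mulrBl (le_trans (nrm_mul _ _))// nrmBC.
    by rewrite -[leRHS]mulr1 ler_pM ?nrm_ge0 ?uy//; exact: ltW.
  rewrite comm -mulrBr (le_trans (nrm_mul _ _))//.
  by rewrite -[leRHS]mul1r ler_pM ?nrm_ge0 ?uy//; exact: ltW.
have {}yE : y = 1 + x * y by apply/subr0_eq.
exists y; split; first split.
- by rewrite mulrBl mul1r {1}yE addrK.
- by rewrite mulrBr mulr1 xy {1}yE addrK.
rewrite -[leRHS]mul1r ler_pdivlMr ?subr_gt0//.
have : nrm y <= 1 + k * nrm y.
  by rewrite {1}yE (le_trans (nrmD _ _))// lerD ?nrm_one ?nrm_mul.
lra.
Qed.

Lemma is_invM x x' y y' : is_inv x x' -> is_inv y y' -> is_inv (x * y) (y' * x').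
Proof.
move=> [xx' x'x] [yy' y'y]; split.
  by rewrite mulrA -(mulrA x) yy' mulr1.
by rewrite mulrA -(mulrA y') x'x mulr1.
Qed.

Lemma is_invZ z x y : z != 0 -> is_inv x y -> is_inv (z *: x) (z^-1 *: y).
Proof.
move=> z0 [xy yx]; split; rewrite -scaleAl -scaleAr scalerA ?mulfV ?mulVf//.
  by rewrite xy scale1r.
by rewrite yx scale1r.
Qed.

Lemma is_inv_star x y : is_inv x y -> is_inv (star x) (star y).
Proof. by move=> [xy yx]; split; rewrite -starM ?xy ?yx star1. Qed.

(** [x - a = x (1 - y a)] with [|y a| <= 1/2], so the Neumann inverse of the second factor has norm
    at most 2. *)
Lemma inv_perturb x y a : is_inv x y -> nrm y * nrm a <= 2^-1 ->
  exists2 y', is_inv (x - a) y' & nrm y' <= 2 * nrm y.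
Proof.
move=> xy ya; have yale : nrm (y * a) <= 2^-1 by rewrite (le_trans (nrm_mul _ _)).
have [|v [vinv vle]] := @neumann (y * a); first by lra.
exists (v * y).
  have -> : x - a = x * (1 - y * a) by rewrite mulrBr mulr1 mulrA xy.1 mul1r.
  exact: is_invM.
rewrite (le_trans (nrm_mul _ _))// ler_wpM2r ?nrm_ge0// (le_trans vle)//.
by rewrite -[leRHS]invrK lef_pV2 ?posrE; lra.
Qed.

End CStar.

(** * Spectrum and resolvent of self-adjoint elements *)

Section SelfAdjoint.
Variables (R : realType) (A : cstarAlgType R).
Implicit Types (a b x y : A) (z w : R[i]) (r t : R).

Lemma complex_ext z w : Re z = Re w -> Im z = Im w -> z = w.
Proof. by case: z w => ? ? [? ?] /= -> ->. Qed.

Lemma nrm_complex z : nrm z ^+ 2 = Re z ^+ 2 + Im z ^+ 2.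
Proof. by apply: complexI; rewrite rmorphXn /= -normE add_Re2_Im2. Qed.

Lemma nrm_Re z : `|Re z| <= nrm z.
Proof. by rewrite -lecR -normE normc_ge_Re. Qed.

Lemma nrm_ReIm z : nrm z <= `|Re z| + `|Im z|.
Proof.
rewrite -(@ler_pXn2r _ 2) ?nnegrE ?nrm_ge0 ?addr_ge0// nrm_complex.
rewrite -(real_normK (num_real (Re z))) -(real_normK (num_real (Im z))).
have := normr_ge0 (Re z); have := normr_ge0 (Im z); nra.
Qed.

Lemma nrm_i : nrm ('i%C : R[i]) = 1.
Proof.
by apply/eqP; rewrite -(@eqrXn2 _ 2) ?nrm_ge0// nrm_complex /= expr0n add0r expr1n.
Qed.

Lemma inv_lt z a : nrm a < nrm z -> exists y, is_inv (a - z *: (1 : A)) y.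
Proof.
move=> az; have z0 : z != 0.
  by apply/eqP => z0; move: az; rewrite z0 nrm0 ltNge nrm_ge0.
have [|y [yi _]] := @neumann R A (z^-1 *: a).
  have : nrm (z^-1) * nrm z = 1 by rewrite -nrmM mulVf// nrmC normr1.
  have := nrm_ge0 z; have := nrm_ge0 (z^-1); rewrite nrmZ; nra.
exists ((- z)^-1 *: y).
have -> : a - z *: (1 : A) = - z *: (1 - z^-1 *: a).
  by rewrite scalerBr scalerA mulNr mulfV// scaleN1r opprK addrC scaleNr.
by apply: is_invZ => //; rewrite oppr_eq0.
Qed.

Lemma star_shift a z : star a = a -> star (a - z *: (1 : A)) = a - (z^*)%C *: (1 : A).
Proof. by move=> sa; rewrite starB starZ sa star1. Qed.

Lemma mul_shift a z w : (a - z *: (1 : A)) * (a - w *: (1 : A)) =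
  a * a - (z + w) *: a + (z * w) *: (1 : A).
Proof.
rewrite mulrBl !mulrBr -!scaleAl -!scaleAr !mul1r !mulr1 scalerDl scalerA.
rewrite opprB opprD !addrA addrAC; congr (_ + _); exact: addrAC.
Qed.

(* If [a - z] were singular for nonreal [z], so would be [(a + i r) - (z + i r)]
   for every real [r], whence [|z + i r|^2 <= |a + i r|^2 <= |a|^2 + r^2]. *)
Lemma sa_spectrum_real a z : star a = a -> Im z != 0 ->
  exists y, is_inv (a - z *: (1 : A)) y.
Proof.
move=> sa zi0; set n := nrm a.
(* With this [r], [|z + i r|^2 = |z|^2 + n^2 + 1 + r^2], which exceeds [n^2 + r^2]. *)
pose r := (n ^+ 2 + 1) / (2 * Im z).
pose w : R[i] := 0 +i* (- r).
have -> : a - z *: (1 : A) = (a - w *: (1 : A)) - (z - w) *: (1 : A).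
  by rewrite [in RHS]scalerBl opprB addrA subrK.
apply: inv_lt.
rewrite -(@ltr_pXn2r _ 2) ?nnegrE ?nrm_ge0//.
rewrite -nrm_cstar star_shift// mul_shift.
have -> : (w^*)%C + w = 0.
  by apply/complex_ext => /=; ring.
have -> : (w^*)%C * w = (r ^+ 2)%:C.
  by apply/complex_ext => /=; ring.
rewrite scale0r subr0; apply: (@le_lt_trans _ _ (n ^+ 2 + r ^+ 2)).
  rewrite (le_trans (nrmD _ _))// lerD ?nrm_sqr_sa// nrmZ nrmC.
  by rewrite ger0_norm ?sqr_ge0// ler_piMr ?sqr_ge0 ?nrm_one.
rewrite nrm_complex.
have -> : Re (z - w) = Re z by case: (z) => u v /=; ring.
have -> : Im (z - w) = Im z + r by case: (z) => u v /=; ring.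
have : 2 * Im z * r = n ^+ 2 + 1 by rewrite /r; field.
by have := sqr_ge0 (Re z); have := sqr_ge0 (Im z); lra.
Qed.

(* The Cayley transform of [a] is unitary. *)
Lemma sa_resolvent_bound a z y : star a = a -> is_inv (a - z *: (1 : A)) y ->
  `|Im z| * nrm y <= 1.
Proof.
move=> sa ay; have ay' := is_inv_star ay; rewrite star_shift// in ay'.
pose u := (a - (z^*)%C *: (1 : A)) * y.
have uu : star u * u = 1.
  rewrite /u starM star_shift// conjcK mulrA -(mulrA (star y)).
  have -> : (a - z *: (1 : A)) * (a - (z^*)%C *: (1 : A)) =
            (a - (z^*)%C *: (1 : A)) * (a - z *: (1 : A)).
    by rewrite !mul_shift (addrC z) (mulrC z).
  by rewrite mulrA ay'.2 mul1r ay.1.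
have u1 : nrm u <= 1.
  have := nrm_cstar u; rewrite uu; have := nrm_one A; have := nrm_ge0 u; nra.
have uE : u - 1 = (2 * 'i%C * (Im z)%:C) *: y.
  rewrite -ay.1 -mulrBl opprB addrC subrKA -scalerBl -scaleAl mul1r.
  by congr (_ *: _); case: (z) => p q; apply/complex_ext => /=; ring.
have : nrm (u - 1) <= 2.
  by rewrite (le_trans (nrmB _ _))//; have := nrm_one A; lra.
rewrite uE nrmZ nrmM nrmC nrmM nrm_i.
have -> : nrm (2 : R[i]) = 2.
  have -> : (2 : R[i]) = (2%:R)%:C by rewrite rmorph_nat.
  by rewrite nrmC ger0_norm.
by lra.
Qed.

(** Partial fractions: [(1 - x^2) y = 1 + x] and [(1 - x^2) y' = 1 - x] add up to 2. *)
Lemma is_inv_average x y y' : is_inv (1 - x) y -> is_inv (1 + x) y' ->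
  is_inv (1 - x * x) (2^-1%:C *: (y + y')).
Proof.
move=> [xy yx] [xy' yx'].
have e1 : 1 - x * x = (1 + x) * (1 - x).
  by rewrite mulrDl mul1r mulrBr mulr1 addrA subrK.
have e2 : 1 - x * x = (1 - x) * (1 + x).
  by rewrite mulrBl mul1r mulrDr mulr1 opprD addrA addrK.
have h : 2^-1%:C *: ((1 + x) + (1 - x)) = 1 :> A.
  have e : (1 : A) + 1 = 2%:R%:C *: (1 : A) by rewrite rmorph_nat scaler_nat mulr2n.
  rewrite addrACA subrr addr0 e scalerA -rmorphM mulVf ?scale1r//.
split; rewrite -?scaleAr -?scaleAl -[RHS]h; congr (_ *: _).
  by rewrite mulrDr {1}e1 e2 -!mulrA xy xy' !mulr1.
by rewrite mulrDl {1}e2 e1 !mulrA yx yx' !mul1r.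
Qed.

End SelfAdjoint.

(** * The spectral radius of a self-adjoint element is its norm *)

Section SpectralRadius.
Variables (R : realType) (A : cstarAlgType R).
Implicit Types (a b x y : A) (z w : R[i]) (r t : R).

Lemma Im_inv z : Im z^-1 * nrm z ^+ 2 = - Im z.
Proof.
have [->|z0] := eqVneq z 0; first by rewrite nrm0 expr0n mulr0 /= oppr0.
have z1 : nrm z ^+ 2 != 0.
  by rewrite expf_neq0//; apply/eqP => /nrm_eq0 /eqP; exact/negP.
move: z1; rewrite nrm_complex; case: (z) => p q /= pq.
by rewrite mulNr mulfVK.
Qed.

Lemma nrm_inv z : nrm z^-1 = (nrm z)^-1.
Proof. by apply: complexI; rewrite -normE normfV normE fmorphV. Qed.

(** [1 - w a = -w (a - w^-1)], and the resolvent bound applies at [w^-1], where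
    [|Im w^-1| = |Im w| / |w|^2]. *)
Lemma sa_resolvent_bound_nonreal a w : star a = a -> Im w != 0 ->
  exists2 y, is_inv (1 - w *: a) y & nrm y <= nrm w / `|Im w|.
Proof.
move=> sa wi; have w0 : w != 0 by apply/eqP => w0; move: wi; rewrite w0 eqxx.
have nw0 : 0 < nrm w by apply/nrm_gt0/eqP.
have wV : Im w^-1 != 0.
  apply/eqP => h; have := Im_inv w; rewrite h mul0r => /esym/eqP.
  by rewrite oppr_eq0; exact/negP.
have [y ay] := sa_spectrum_real sa wV.
exists ((- w)^-1 *: y).
  have -> : 1 - w *: a = - w *: (a - w^-1 *: (1 : A)).
    by rewrite scalerBr scalerA mulNr mulfV// scaleN1r opprK addrC scaleNr.
  by apply: is_invZ => //; rewrite oppr_eq0.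
rewrite nrmZ nrm_inv nrmN ler_pdivlMr ?normr_gt0//.
have -> : `|Im w| = `|Im w^-1| * nrm w ^+ 2.
  by rewrite -[in RHS](ger0_norm (sqr_ge0 (nrm w))) -normrM Im_inv normrN.
have -> : (nrm w)^-1 * nrm y * (`|Im w^-1| * nrm w ^+ 2) =
          nrm w * (`|Im w^-1| * nrm y) by field; rewrite gt_eqF.
by rewrite ler_piMr ?nrm_ge0// (sa_resolvent_bound sa ay).
Qed.

(** Away from the real axis the bound for nonreal [w] applies. The rest of a thin annulus lies near
    1 or -1, where the given inverses are perturbed. *)
Lemma resolvent_bound_near_circle a : star a = a -> nrm a = 1 ->
  (exists y, is_inv (1 - a) y) -> (exists y, is_inv (1 + a) y) ->
  exists K e, [/\ 0 < K, 0 < e, e < 1 & forall w, 1 - e <= nrm w <= 1 + e ->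
    exists2 y, is_inv (1 - w *: a) y & nrm y <= K].
Proof.
move=> sa a1 [y0 ay0] [y1 ay1].
(* [d k = 1/2] puts perturbations of size [d] in the range of [inv_perturb]. The constant [16 k] is
   [2 / (d / 4)], the nonreal bound when [|Im w| >= d / 4] and [|w| <= 2]. *)
pose k := 1 + nrm y0 + nrm y1; pose d := (2 * k)^-1.
have n0 := nrm_ge0 y0; have n1 := nrm_ge0 y1.
have k1 : 1 <= k by rewrite /k; lra.
have dk : d * k = 2^-1 by rewrite /d; field; rewrite gt_eqF//; exact: lt_le_trans k1.
have d0 : 0 < d by rewrite invr_gt0; lra.
have d1 : d <= 2^-1 by rewrite -dk ler_peMr// ltW.
exists (16 * k), (d / 4); split; [lra|lra|lra|] => w wle.
have near1 x y b : is_inv x y -> nrm y <= k -> nrm b <= d ->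
    exists2 y', is_inv (x - b) y' & nrm y' <= 16 * k.
  move=> xy yk bd; have [|y' xy' y'le] := inv_perturb xy (a := b).
    by rewrite -dk mulrC ler_pM ?nrm_ge0.
  by exists y' => //; rewrite (le_trans y'le)//; lra.
have [wi|wi] := leP (d / 4) `|Im w|.
  have [|y ay yle] := sa_resolvent_bound_nonreal (w := w) sa.
    by rewrite -normr_gt0; lra.
  exists y => //; rewrite (le_trans yle)// ler_pdivrMr; last by lra.
  have : 16 * k * (d / 4) = 2.
    have -> : 16 * k * (d / 4) = 4 * (d * k) by field.
    by rewrite dk; field.
  nra.
have h1 := nrm_Re w; have h2 := nrm_ReIm w.
have [wr|wr] := leP 0 (Re w).
  have -> : 1 - w *: a = 1 - a - (w - 1) *: a.
    by rewrite scalerBl scale1r opprB addrA subrK.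
  apply: near1 ay0 _ _; first by rewrite /k; lra.
  rewrite nrmZ a1 mulr1 (le_trans (nrm_ReIm _))//.
  have -> : Re (w - 1) = Re w - 1 by case: (w).
  have -> : Im (w - 1) = Im w by case: (w) => ? ? /=; rewrite subr0.
  rewrite ger0_norm in h1 => //; rewrite ger0_norm in h2 => //.
  by have : `|Re w - 1| <= d / 2; [rewrite ler_norml; lra | lra].
have -> : 1 - w *: a = 1 + a - (w + 1) *: a.
  by rewrite scalerDl scale1r opprD addrACA subrr addr0.
apply: near1 ay1 _ _; first by rewrite /k; lra.
rewrite nrmZ a1 mulr1 (le_trans (nrm_ReIm _))//.
have -> : Re (w + 1) = Re w + 1 by case: (w).
have -> : Im (w + 1) = Im w by case: (w) => ? ? /=; rewrite addr0.
rewrite ltr0_norm in h1 => //; rewrite ltr0_norm in h2 => //.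
by have : `|Re w + 1| <= d / 2; [rewrite ler_norml; lra | lra].
Qed.

Definition resolvent_close a r s := forall w, nrm w = 1 ->
  exists y y', [/\ is_inv (1 - (r%:C * w) *: a) y,
    is_inv (1 - (s%:C * w) *: a) y' & nrm (y - y') <= 4^-1].

(** For [v^2 = w] the resolvents of [a^2] at [w] are averages of those of [a] at [v] and [-v], so
    the same constant [1/4] survives every squaring. *)
Lemma resolvent_close_sqr a r s :
  resolvent_close a r s -> resolvent_close (a * a) (r ^+ 2) (s ^+ 2).
Proof.
move=> ars w w1; pose v := sqrtC w.
have vv : v * v = w by rewrite -expr2 sqrtCK.
have v1 : nrm v = 1.
  by apply/eqP; rewrite -(@eqrXn2 _ 2) ?nrm_ge0// expr2 -nrmM vv w1 expr1n.
have [x [x' [ax ax' xx']]] := ars v v1.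
have [|y [y' [ay ay' yy']]] := ars (- v); first by rewrite nrmN.
have e t : 1 - ((t ^+ 2)%:C * w) *: (a * a) =
    1 - (t%:C * v) *: a * ((t%:C * v) *: a).
  by rewrite -scaleAl -scaleAr scalerA mulrACA vv -rmorphM.
have eN t : 1 - (t%:C * - v) *: a = 1 + (t%:C * v) *: a.
  by rewrite mulrN scaleNr opprK.
rewrite eN in ay; rewrite eN in ay'.
exists (2^-1%:C *: (x + y)), (2^-1%:C *: (x' + y')); split.
- by rewrite e; exact: is_inv_average.
- by rewrite e; exact: is_inv_average.
rewrite -scalerBr nrmZ nrmC ger0_norm ?invr_ge0// opprD addrACA.
by have := nrmD (x - x') (y - y'); lra.
Qed.

(* Rickart's argument: as [(1 - b^2)^-1] is the average of [(1 - b)^-1] and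
   [(1 + b)^-1], closeness of the resolvents on two circles, one on each side of
   the unit circle, passes from [a] to its [2^k]-th powers. Inside they tend to
   1, and outside they tend to 0. *)
Lemma sa_nrm1_spectrum a : star a = a -> nrm a = 1 ->
  (exists y, is_inv (1 - a) y) -> (exists y, is_inv (1 + a) y) -> False.
Proof.
move=> sa a1 h0 h1.
have [K [e [K0 e0 e1 res]]] := resolvent_bound_near_circle sa a1 h0 h1.
(* By the resolvent identity the resolvents on the circles of radius [1 - d] and [1 + d] differ by
   at most [K (2 d) K]; this [d] makes that at most [1/4]. *)
pose d := Num.min e (8 * K ^+ 2)^-1.
have d0 : 0 < d by rewrite lt_min e0 invr_gt0 mulr_gt0// exprn_gt0.
have de : d <= e by rewrite ge_min lexx.
have dK : K ^+ 2 * (2 * d) <= 4^-1.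
  have : d <= (8 * K ^+ 2)^-1 by rewrite ge_min lexx orbT.
  move=> /(ler_wpM2l (exprn_ge0 2 (ltW K0))).
  have -> : K ^+ 2 * (8 * K ^+ 2)^-1 = 8^-1 by field; rewrite gt_eqF.
  lra.
have cl0 : resolvent_close a (1 - d) (1 + d).
  move=> w w1.
  have nw t : 0 <= t -> nrm (t%:C * w) = t.
    by move=> t0; rewrite nrmM nrmC w1 mulr1 ger0_norm.
  have [|y ay yK] := res ((1 - d)%:C * w); first by rewrite nw; lra.
  have [|y' ay' y'K] := res ((1 + d)%:C * w); first by rewrite nw; lra.
  exists y, y'; split => //.
  have -> : y - y' = y * (((1 - d)%:C * w - (1 + d)%:C * w) *: a) * y'.
    have -> : ((1 - d)%:C * w - (1 + d)%:C * w) *: a =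
        1 - ((1 + d)%:C * w) *: a - (1 - ((1 - d)%:C * w) *: a).
      by rewrite scalerBl opprB [RHS]addrC subrKA.
    by rewrite mulrBr mulrBl -mulrA ay'.1 mulr1 ay.2 mul1r.
  rewrite (le_trans (nrm_mul _ _))// (le_trans _ dK)//.
  have -> : K ^+ 2 * (2 * d) = K * (2 * d) * K by ring.
  rewrite ler_pM ?nrm_ge0// (le_trans (nrm_mul _ _))// ler_pM ?nrm_ge0//.
  rewrite nrmZ a1 mulr1 -mulrBl nrmM w1 mulr1 -rmorphB nrmC ler_norml; lra.
pose b k := iter k (fun x => x * x) a.
have sb k : star (b k) = b k by elim: k => //= k IH; rewrite starM IH.
have nb k : nrm (b k) = 1.
  by elim: k => //= k IH; rewrite nrm_sqr_sa ?sb// IH expr1n.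
have clk k : resolvent_close (b k) ((1 - d) ^+ (2 ^ k)) ((1 + d) ^+ (2 ^ k)).
  elim: k => [|k IH]; first by rewrite !expr1.
  by rewrite expnS mulnC !exprM; exact: resolvent_close_sqr.
(* Once the outer radius [s] is at least 8, the inner one [r] is at most [1/8], because
   [(1 - d) (1 + d) <= 1]. *)
have [k] : exists k, 8 <= (1 + d) ^+ (2 ^ k).
  apply: contrapT => /forallNP h.
  suff : (8^-1 : R) <= 0 by lra.
  apply: (@geometric_le0 _ _ 1 (1 + d)^-1) => [||n].
  - by rewrite invr_ge0; lra.
  - by rewrite invf_lt1; lra.
  rewrite mul1r exprVn lef_pV2 ?posrE ?exprn_gt0//; last by lra.
  have := h n; move/negP; rewrite -ltNge => /ltW; apply: le_trans.
  by rewrite ler_weXn2l//; [lra | exact/ltnW/ltn_expl].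
set s := _ ^+ _ => s8.
have [y [y' []]] := clk k 1 (etrans (nrmC 1) (normr1 R)).
set r := (1 - d) ^+ _; rewrite -/s !mulr1 => ay ay' yy'.
have r0 : 0 <= r by apply: exprn_ge0; lra.
have rs : r * s <= 1.
  by rewrite /r /s -exprMn; apply: exprn_ile1; nra.
have r8 : r <= 8^-1 by nra.
have y1 : nrm (y - 1) <= 7^-1.
  have yE : y - 1 = r%:C *: b k * y.
    by rewrite -[in LHS]ay.1 mulrBl mul1r opprB addrC subrK.
  have : nrm (y - 1) <= r * nrm y.
    by rewrite yE (le_trans (nrm_mul _ _))// nrmZ nb mulr1 nrmC ger0_norm//.
  have : nrm y <= nrm (y - 1) + 1.
    by rewrite -{1}(subrK 1 y) (le_trans (nrmD _ _))// lerD2l nrm_one.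
  have := nrm_ge0 y; nra.
(* The outer resolvent [y' = 1 + f] is close to 1 like the inner one. Then [s b = f - f (s b)] with
   [|f| <= 1/2] forces [|s b| <= 1], against [|s b| = s >= 8]. *)
pose f : A := y' - 1.
have f1 : nrm f <= 2^-1.
  have := nrm_triangle y y' 1; rewrite (nrmBC y' y) -/f; lra.
have xE : s%:C *: b k = f - f * (s%:C *: b k).
  have : y' - y' * (s%:C *: b k) = 1 by rewrite -ay'.2 mulrBr mulr1.
  rewrite /f mulrBl mul1r opprB => h.
  by rewrite [X in _ + X]addrC addrACA h addrA subrr add0r.
have : nrm (s%:C *: b k) <= 2^-1 + 2^-1 * nrm (s%:C *: b k).
  rewrite {1}xE (le_trans (nrmB _ _))// lerD// (le_trans (nrm_mul _ _))//.
  by rewrite ler_wpM2r ?nrm_ge0.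
rewrite nrmZ nb mulr1 nrmC ger0_norm; lra.
Qed.

(** If [t < |a|], both [|a|] and [-|a|] avoid the spectrum, so [a / |a|] has norm 1 with neither 1
    nor -1 in its spectrum. *)
Lemma sa_nrm_le a t : star a = a -> 0 <= t ->
  (forall r, t < `|r| -> exists y, is_inv (a - r%:C *: (1 : A)) y) ->
  nrm a <= t.
Proof.
move=> sa t0 h; rewrite leNgt; apply/negP => ta.
have n0 : 0 < nrm a by apply: le_lt_trans ta.
have n0' : (nrm a)%:C != 0 :> R[i].
  by rewrite -(rmorph0 (real_complex R)) (inj_eq (@complexI R)) gt_eqF.
pose c := (nrm a)%:C^-1 *: a.
have cE : (nrm a)%:C *: c = a by rewrite scalerA mulfV// scale1r.
have sc : star c = c by rewrite /c -fmorphV starZr sa.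
apply: (@sa_nrm1_spectrum c) => //.
- by rewrite /c nrmZ nrm_inv nrmC ger0_norm ?nrm_ge0// mulVf ?gt_eqF.
- have [|y ay] := h (nrm a); first by rewrite ger0_norm ?ltW.
  exists (- (nrm a)%:C *: y).
  have -> : 1 - c = (- (nrm a)%:C)^-1 *: (a - (nrm a)%:C *: (1 : A)).
    by rewrite scalerBr scalerA invrN mulNr mulVf// scaleN1r opprK scaleNr addrC.
  rewrite -{2}(invrK (- (nrm a)%:C)); apply: is_invZ => //.
  by rewrite invr_eq0 oppr_eq0.
have [|y ay] := h (- nrm a); first by rewrite normrN ger0_norm ?ltW.
exists ((nrm a)%:C *: y).
have -> : 1 + c = (nrm a)%:C^-1 *: (a - (- nrm a)%:C *: (1 : A)).
  by rewrite rmorphN /= scaleNr opprK scalerDr scalerA mulVf// scale1r addrC.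
by rewrite -{2}(invrK (nrm a)%:C); apply: is_invZ => //; rewrite invr_eq0.
Qed.

End SpectralRadius.

(** * The positive cone and monotonicity of the norm *)

Section Positivity.
Variables (R : realType) (A : cstarAlgType R).
Implicit Types (a b c x y : A) (z : R[i]) (r t : R).

Lemma is_invN x y : is_inv x y -> is_inv (- x) (- y).
Proof. by move=> [xy yx]; split; rewrite mulrNN. Qed.

Lemma sub_shift a r t :
  r%:C *: (1 : A) - a - t%:C *: (1 : A) = - (a - (r - t)%:C *: (1 : A)).
Proof. by rewrite rmorphB /= scalerBl opprB addrAC. Qed.

Lemma inv_sub_shift a r t : (exists y, is_inv (a - (r - t)%:C *: (1 : A)) y) ->
  exists y, is_inv (r%:C *: (1 : A) - a - t%:C *: (1 : A)) y.
Proof. by move=> [y ay]; exists (- y); rewrite sub_shift; exact: is_invN. Qed.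

Lemma star_sub_shift a r : star a = a ->
  star (r%:C *: (1 : A) - a) = r%:C *: (1 : A) - a.
Proof. by move=> sa; rewrite starB starZr star1 sa. Qed.

Lemma cpos_real_inv a r : cpos a -> r < 0 ->
  exists y, is_inv (a - r%:C *: (1 : A)) y.
Proof.
move=> [_ ap] r0; apply: contrapT => h.
by have := ap r%:C h; rewrite ler0c leNgt r0.
Qed.

(** With its converse below, this turns positivity into a norm inequality, for which sums are
    handled by the triangle inequality. A real [r > t] is excluded from the spectrum of [t - a] by
    positivity, and [r < -t] by [|a| <= t]. *)
Lemma cpos_nrm_sub a t : cpos a -> nrm a <= t -> nrm (t%:C *: (1 : A) - a) <= t.
Proof.
move=> ap at_; have t0 : 0 <= t by apply: le_trans at_; exact: nrm_ge0.
apply: sa_nrm_le => //; first exact: star_sub_shift ap.1.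
move=> r tr; apply: inv_sub_shift.
have [rt|rt] := ltP t r; first by apply: cpos_real_inv => //; lra.
apply: inv_lt; rewrite nrmC (le_lt_trans at_)//.
by move: tr; rewrite !ltr_normr; case/orP => ?; apply/orP; left; lra.
Qed.

Lemma nrm_sub_cpos a t : star a = a -> nrm (t%:C *: (1 : A) - a) <= t -> cpos a.
Proof.
move=> sa ta; split => // z az.
have zi : Im z = 0.
  by apply/eqP; apply: contrapT => /negP zi; apply: az; exact: sa_spectrum_real.
have zE : z = (t - (t - Re z))%:C.
  by apply: complex_ext => //=; ring.
rewrite lecE zi eqxx /= leNgt; apply/negP => z0; apply: az.
have [|y ay] := @inv_lt R A (t - Re z)%:C (t%:C *: (1 : A) - a).
  by rewrite nrmC (le_lt_trans ta)// ltr_normr; apply/orP; left; lra.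
exists (- y); rewrite zE -[_ - _]opprK -sub_shift; exact: is_invN.
Qed.

Lemma cposD a b : cpos a -> cpos b -> cpos (a + b).
Proof.
move=> ap bp; apply: (@nrm_sub_cpos _ (nrm a + nrm b)).
  by rewrite starD ap.1 bp.1.
rewrite rmorphD /= scalerDl opprD addrACA (le_trans (nrmD _ _))//.
by rewrite lerD// cpos_nrm_sub.
Qed.

Lemma cposZ r a : 0 <= r -> cpos a -> cpos (r%:C *: a).
Proof.
move=> r0 ap; apply: (@nrm_sub_cpos _ (r * nrm a)).
  by rewrite starZr ap.1.
rewrite rmorphM -scalerA -scalerBr nrmZ nrmC ger0_norm//.
by rewrite ler_wpM2l// cpos_nrm_sub.
Qed.

Lemma cle_trans b a c : a <=* b -> b <=* c -> a <=* c.
Proof. by move=> ab bc; rewrite /cle -(subrKA b) addrC; exact: cposD. Qed.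

Lemma cleZ r a b : 0 <= r -> a <=* b -> r%:C *: a <=* r%:C *: b.
Proof. by move=> r0 ab; rewrite /cle -scalerBr; exact: cposZ. Qed.

(** [|b| - a] is the sum of the positive elements [|b| - b] and [b - a], so the spectrum of [a] lies
    in [[0, |b|]]. *)
Lemma cle_nrm a b : cpos a -> a <=* b -> nrm a <= nrm b.
Proof.
move=> ap ab.
have bp : cpos b by rewrite -(subrK a b); exact: cposD.
have nb : cpos ((nrm b)%:C *: (1 : A) - b).
  apply: (@nrm_sub_cpos _ (nrm b)); first exact: star_sub_shift bp.1.
  by rewrite opprB addrC subrK.
have na : cpos ((nrm b)%:C *: (1 : A) - a) := cle_trans ab nb.
apply: sa_nrm_le; [exact: ap.1|exact: nrm_ge0|move=> r br].
have [r0|r0] := ltP r 0; first exact: cpos_real_inv.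
rewrite ger0_norm// in br.
have [|y ay] := @cpos_real_inv _ (nrm b - r) na; first by lra.
exists (- y); rewrite -[a - _]opprK; apply: is_invN.
by move: ay; rewrite sub_shift subKr.
Qed.

End Positivity.

(** * Inner products, polarization and symmetric operators *)

Section HilbertModule.
Variables (R : realType) (A : cstarAlgType R) (H : hilbertModType A).
Implicit Types (f g h : H) (z : R[i]) (r : R) (S T Z : H -> H).

Lemma ipZl z f g : ip (z *: f) g = z *: ip f g.
Proof. by rewrite -(act1 f) -actZ ip_act -scaleAl mul1r act1. Qed.

Lemma ipDr f g h : ip f (g + h) = ip f g + ip f h.
Proof. by rewrite ip_star ipDl starD -!ip_star. Qed.

Lemma ipZr z f g : ip f (z *: g) = Num.conj z *: ip f g.
Proof. by rewrite ip_star ipZl starZ -ip_star. Qed.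

Lemma ipZrr r f g : ip f (r%:C *: g) = r%:C *: ip f g.
Proof. by rewrite ipZr conj_Creal// complex_real. Qed.

Lemma ipNl f g : ip (- f) g = - ip f g.
Proof. by rewrite -scaleN1r ipZl scaleN1r. Qed.

Lemma ipNr f g : ip f (- g) = - ip f g.
Proof. by rewrite ip_star ipNl starN -ip_star. Qed.

Lemma ipBl f g h : ip (f - g) h = ip f h - ip g h.
Proof. by rewrite ipDl ipNl. Qed.

Lemma ipBr f g h : ip f (g - h) = ip f g - ip f h.
Proof. by rewrite ipDr ipNr. Qed.

Lemma ip0l f : ip 0 f = 0.
Proof. by rewrite -(subrr (0 : H)) ipBl subrr. Qed.

Lemma ip0r f : ip f 0 = 0.
Proof. by rewrite -(subrr (0 : H)) ipBr subrr. Qed.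

Lemma ip_inj f g : (forall h, ip f h = ip g h) -> f = g.
Proof. by move=> fg; apply/subr0_eq/ip_eq0; rewrite ipBl fg subrr. Qed.

Lemma nrm_ip f : nrm (ip f f) = nrm f ^+ 2.
Proof.
by apply: complexI; rewrite rmorphXn /= -!normE norm_ipE sqrtCK.
Qed.

(** Kept general in [B], as it serves both the inner product and the form measuring the failure of
    an operator to be symmetric. *)
Lemma polarization (B : H -> H -> A) :
  (forall f g h, B (f + g) h = B f h + B g h) ->
  (forall f g h, B f (g + h) = B f g + B f h) ->
  (forall f g, B ('i%C *: f) g = 'i%C *: B f g) ->
  (forall f g, B f ('i%C *: g) = - 'i%C *: B f g) ->
  forall f g, B f g *+ 2 =
  (B (f + g) (f + g) - B f f - B g g) -
  'i%C *: (B ('i%C *: f + g) ('i%C *: f + g) - B ('i%C *: f) ('i%C *: f) - B g g).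
Proof.
move=> BDl BDr Bil Bir f g.
have cross u v : B (u + v) (u + v) - B u u - B v v = B u v + B v u.
  rewrite -[LHS]addrA -opprD BDl !BDr [B v u + _]addrC addrACA.
  by rewrite addrAC subrr add0r.
have ii : 'i%C * 'i%C = -1 :> R[i] by rewrite -expr2 sqr_i.
rewrite !cross Bil Bir scalerDr !scalerA mulrN ii opprK scaleN1r scale1r.
by rewrite opprD opprK addrACA subrr addr0 mulr2n.
Qed.

Lemma conj_i : Num.conj 'i%C = - 'i%C :> R[i].
Proof. by apply/complex_ext => /=; rewrite ?oppr0. Qed.

(* Polarization gives the Cauchy-Schwarz inequality only up to a constant, which
   is enough for continuity of the inner product. *)
Lemma nrm_ip_le f g : nrm (ip f g) <= 6 * (nrm f * nrm g).
Proof.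
have unit (u v : H) : nrm u = 1 -> nrm v = 1 -> nrm (ip u v) <= 6.
  move=> u1 v1.
  have iu1 : nrm ('i%C *: u) = 1 by rewrite nrmZ nrm_i u1 mulr1.
  have le6 (w : H) : nrm w = 1 -> nrm (ip (w + v) (w + v) - ip w w - ip v v) <= 6.
    move=> w1; have := nrmB (ip (w + v) (w + v) - ip w w) (ip v v).
    have := nrmB (ip (w + v) (w + v)) (ip w w).
    rewrite !nrm_ip w1 v1; have := nrmD w v; have := nrm_ge0 (w + v).
    rewrite w1 v1; nra.
  have := @polarization (@ip R A H) ipDl ipDr (ipZl _) _ u v.
  move=> /(_ (fun f' g' => etrans (ipZr _ f' g') _)).
  move=> /(_ (fun f' g' => congr1 (fun z => z *: _) conj_i)) e.
  have : nrm (ip u v *+ 2) <= 12.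
    rewrite e (le_trans (nrmB _ _))// nrmZ nrm_i mul1r.
    by have := le6 _ u1; have := le6 _ iu1; lra.
  have -> : ip u v *+ 2 = (2 : R)%:C *: ip u v by rewrite rmorph_nat scaler_nat.
  by rewrite nrmZ nrmC ger0_norm//; lra.
have [->|/eqP/nrm_gt0 f0] := eqVneq f 0; first by rewrite ip0l !nrm0 mul0r mulr0.
have [->|/eqP/nrm_gt0 g0] := eqVneq g 0; first by rewrite ip0r !nrm0 !mulr0.
have norm1 h : 0 < nrm h -> nrm ((nrm h)^-1%:C *: h) = 1.
  by move=> h0; rewrite nrmZ nrmC ger0_norm ?invr_ge0 ?ltW// mulVf ?gt_eqF.
have := unit _ _ (norm1 f f0) (norm1 g g0).
rewrite ipZl ipZrr !nrmZ !nrmC !ger0_norm ?invr_ge0 ?nrm_ge0// => h.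
by rewrite -ler_pdivrMr ?mulr_gt0// invfM mulrC -mulrA.
Qed.

(** Symmetry already implies linearity, by nondegeneracy of the inner product, so operators obtained
    as limits can be plain functions. *)
Definition symop T := forall f g, ip (T f) g = ip f (T g).

Lemma symopD T f g : symop T -> T (f + g) = T f + T g.
Proof. by move=> sT; apply: ip_inj => h; rewrite ipDl !sT ipDl. Qed.

Lemma symopZ T z f : symop T -> T (z *: f) = z *: T f.
Proof. by move=> sT; apply: ip_inj => h; rewrite ipZl !sT ipZl. Qed.

Lemma symopB T f g : symop T -> T (f - g) = T f - T g.
Proof. by move=> sT; rewrite symopD// -scaleN1r symopZ// scaleN1r. Qed.

(** The form [<T f, g> - <f, T g>] vanishes on the diagonal because positive elements are
    self-adjoint; polarization makes it zero. *)
Lemma positive_symop (T : {linear H -> H}) : positive_op T -> symop T.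
Proof.
move=> Tp f g; apply/subr0_eq.
pose B f g := ip (T f) g - ip f (T g).
have B0 h : B h h = 0.
  by rewrite /B [ip h _]ip_star (Tp h).1 subrr.
have := @polarization B _ _ _ _ f g; rewrite !B0 !subrr scaler0 subr0.
move=> h; have {h} : B f g *+ 2 = 0.
  apply: h => u v.
  - by move=> w; rewrite /B linearD !ipDl opprD addrACA.
  - by move=> w; rewrite /B linearD !ipDr opprD addrACA.
  - by rewrite /B linearZ /= !ipZl scalerBr.
  - by rewrite /B linearZ /= !ipZr conj_i scalerBr.
by rewrite -scaler_nat => /eqP; rewrite scaler_eq0 pnatr_eq0 => /eqP.
Qed.

End HilbertModule.

(** * Limits with a geometric rate *)

Section GeometricLimit.
Variables (R : realType) (V : normedModType R[i]).
Implicit Types (u v : nat -> V) (l : V).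

Definition geo_cvg (q : R) u l := exists c, forall n, nrm (u n - l) <= c * q ^+ n.

Lemma geo_cvg_unique q u l l' : 0 <= q -> q < 1 ->
  geo_cvg q u l -> geo_cvg q u l' -> l = l'.
Proof.
move=> q0 q1 [c ul] [c' ul'].
apply/subr0_eq/(@nrm_geometric0 _ _ _ (c + c') q) => // n.
rewrite (le_trans (nrm_triangle (u n) _ _))// mulrDl lerD// nrmBC; exact: ul.
Qed.

Lemma geo_cvgS q u l : geo_cvg q u l -> geo_cvg q (fun n => u n.+1) l.
Proof.
by move=> [c ul]; exists (c * q) => n; rewrite -mulrA -exprS.
Qed.

Lemma geo_cvgDl q u l f : geo_cvg q u l -> geo_cvg q (fun n => f + u n) (f + l).
Proof. by move=> [c ul]; exists c => n; rewrite opprD addrACA subrr add0r. Qed.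

Lemma geo_cvgZ q u l z : geo_cvg q u l -> geo_cvg q (fun n => z *: u n) (z *: l).
Proof.
move=> [c ul]; exists (nrm z * c) => n.
by rewrite -scalerBr nrmZ -mulrA ler_wpM2l ?nrm_ge0.
Qed.

End GeometricLimit.

(** * Square root of [1 - X] for a symmetric strict contraction [X] *)

Section SquareRoot.
Variables (R : realType) (A : cstarAlgType R) (H : hilbertModType A).
Implicit Types (f g : H) (Z : H -> H).

Lemma geo_cvg_ipl q (u : nat -> H) l g : geo_cvg q u l ->
  geo_cvg q (fun n => ip (u n) g) (ip l g).
Proof.
move=> [c ul]; exists (6 * nrm g * c) => n.
rewrite -ipBl (le_trans (nrm_ip_le _ _))// -!mulrA ler_wpM2l//.
by rewrite mulrC ler_wpM2l ?nrm_ge0.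
Qed.

Lemma geo_cvg_ipr q (u : nat -> H) l g : geo_cvg q u l ->
  geo_cvg q (fun n => ip g (u n)) (ip g l).
Proof.
move=> [c ul]; exists (6 * nrm g * c) => n.
rewrite -ipBr (le_trans (nrm_ip_le _ _))// -!mulrA ler_wpM2l//.
by rewrite ler_wpM2l ?nrm_ge0.
Qed.

Variables (X : H -> H) (k : R).
Hypotheses (symX : symop X) (k0 : 0 <= k) (k1 : k < 1).
Hypothesis X_le : forall f, nrm (X f) <= k * nrm f.

(* [1 - Y] with [Y = (X + Y^2) / 2] squares to [1 - X]. *)
Fixpoint sqrt_iter n f : H := if n is n'.+1 then
  (2^-1 : R)%:C *: (X f + sqrt_iter n' (sqrt_iter n' f)) else 0.

Let Y := sqrt_iter.

Let symY n : symop (Y n).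
Proof.
elim: n => [|n IH] f g /=; first by rewrite ip0l ip0r.
by rewrite ipZl ipZrr ipDl ipDr symX !IH.
Qed.

Let Y_le n f : nrm (Y n f) <= k * nrm f.
Proof.
elim: n f => [|n IH] f /=; first by rewrite nrm0 mulr_ge0 ?nrm_ge0.
rewrite nrmZ nrmC ger0_norm ?invr_ge0//.
have YY : nrm (Y n (Y n f)) <= k * nrm f.
  rewrite (le_trans (IH _))// ler_wpM2l// (le_trans (IH f))//.
  by rewrite ler_piMl ?nrm_ge0// ltW.
have := nrmD (X f) (Y n (Y n f)); have := X_le f; rewrite -/Y; lra.
Qed.

Let Y_step n f : nrm (Y n.+1 f - Y n f) <= k * nrm f * k ^+ n.
Proof.
elim: n f => [|n IH] f; first by rewrite subr0 expr0 mulr1 Y_le.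
(* [Y_(n+1)^2 - Y_n^2 = Y_(n+1) (Y_(n+1) - Y_n) + (Y_(n+1) - Y_n) Y_n]; each term gains a factor
   [k], and the half absorbs their number. *)
have -> : Y n.+2 f - Y n.+1 f = (2^-1 : R)%:C *:
    (Y n.+1 (Y n.+1 f - Y n f) + (Y n.+1 (Y n f) - Y n (Y n f))).
  rewrite (symopB _ _ (symY _)) subrKA -[_ - Y n (Y n f)]add0r -(subrr (X f)).
  by rewrite addrACA -opprD scalerBr.
rewrite nrmZ nrmC ger0_norm ?invr_ge0//.
have := nrmD (Y n.+1 (Y n.+1 f - Y n f)) (Y n.+1 (Y n f) - Y n (Y n f)).
have := Y_le n.+1 (Y n.+1 f - Y n f).
have := ler_wpM2l k0 (IH f).
have := IH (Y n f).
have : k * nrm (Y n f) * k ^+ n <= k * (k * nrm f) * k ^+ n.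
  by rewrite ler_wpM2r ?exprn_ge0// ler_wpM2l.
have -> : k * nrm f * k ^+ n.+1 = k * (k * nrm f * k ^+ n) by rewrite exprS; ring.
have -> : k * (k * nrm f) * k ^+ n = k * (k * nrm f * k ^+ n) by ring.
lra.
Qed.

Lemma sqrt_one_sub : exists S : H -> H, [/\ symop S,
  forall f, S (S f) = f - X f &
  forall Z, symop Z -> (forall f, Z (X f) = X (Z f)) ->
    forall f, Z (S f) = S (Z f)].
Proof.
have /choice[L YL] : forall f, exists l, geo_cvg k (fun n => Y n f) l.
  move=> f; have [l Yl] := geometric_cvg k0 k1 (Y_step^~ f).
  by exists l, (k * nrm f / (1 - k)) => n; rewrite mulrAC.
have symL : symop L.
  move=> f g; apply: (geo_cvg_unique k0 k1 (geo_cvg_ipl g (YL f))).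
  rewrite (_ : (fun n => _) = fun n => ip f (Y n g)); first exact: geo_cvg_ipr.
  by apply/funext => n; exact: symY.
have YYL f : geo_cvg k (fun n => Y n (Y n f)) (L (L f)).
  have [c Lf] := YL f; have [d LLf] := YL (L f).
  exists (c + d) => n; rewrite (le_trans (nrm_triangle (Y n (L f)) _ _))//.
  rewrite mulrDl lerD// -(symopB _ _ (symY n)) (le_trans (Y_le _ _))//.
  by rewrite (le_trans _ (Lf n))// ler_piMl ?nrm_ge0// ltW.
have LE f : L f = (2^-1 : R)%:C *: (X f + L (L f)).
  apply: (geo_cvg_unique k0 k1 (geo_cvgS (YL f))).
  exact/geo_cvgZ/geo_cvgDl.
(* [2 L = X + L^2] is the identity [(1 - L)^2 = 1 - X]. *)
have L2 f : L f + L f = X f + L (L f).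
  rewrite {1 2}LE -scalerDl -rmorphD /=.
  by rewrite (_ : 2^-1 + 2^-1 = 1) ?scale1r//; field.
exists (fun f => f - L f); split.
- by move=> f g; rewrite ipBl ipBr symL.
- move=> f; rewrite symopB// opprB -addrA; congr (f + _).
  by rewrite addrCA -opprD L2 opprD addrCA subrr addr0.
move=> Z symZ ZX f; rewrite symopB//; congr (_ - _).
have ZY n h : Z (Y n h) = Y n (Z h).
  elim: n h => [|n IH] h /=; first by rewrite -(scale0r (0 : H)) symopZ// !scale0r.
  by rewrite symopZ// symopD// ZX !IH.
(* Moving [Z] onto [g] leaves only [Y n f] to pass to the limit. *)
apply: ip_inj => g; rewrite symZ.
apply: (geo_cvg_unique k0 k1 (geo_cvg_ipl (Z g) (YL f))).
rewrite (_ : (fun n => _) = fun n => ip (Y n (Z f)) g); first exact: geo_cvg_ipl.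
by apply/funext => n; rewrite -symZ ZY.
Qed.

End SquareRoot.

(** * Order bounds and square roots of positive operators *)

Section PositiveOperators.
Variables (R : realType) (A : cstarAlgType R) (H : hilbertModType A).
Implicit Types (f g : H) (T : H -> H) (k : R).

(** [k - T = k S^2] with [S] the root of [1 - T / k], so the difference of the two sides is
    [k <S f, S f>]. *)
Lemma symop_le T M k : symop T -> (forall f, nrm (T f) <= M * nrm f) ->
  M < k -> 0 < k -> forall f, ip (T f) f <=* k%:C *: ip f f.
Proof.
move=> sT TM Mk k0 f.
pose X g : H := k^-1%:C *: T g.
have sX : symop X by move=> g h; rewrite /X ipZl ipZrr sT.
pose c := Num.max 0 (M / k).
have c0 : 0 <= c by rewrite le_max lexx.
have c1 : c < 1 by rewrite gt_max ltr01 ltr_pdivrMr// mul1r.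
have Xc g : nrm (X g) <= c * nrm g.
  rewrite nrmZ nrmC ger0_norm ?invr_ge0 ?(ltW k0)//.
  apply: (@le_trans _ _ (M / k * nrm g)).
    by rewrite mulrAC [leRHS]mulrC ler_wpM2l// invr_ge0 ltW.
  by rewrite ler_wpM2r ?nrm_ge0// le_max lexx orbT.
have [S [sS SS _]] := sqrt_one_sub sX c0 c1 Xc.
rewrite /cle (_ : _ - _ = k%:C *: ip (S f) (S f)).
  by apply: cposZ (ip_ge0 _); exact: ltW.
rewrite sS SS ipBr scalerBr ipZrr scalerA -rmorphM mulfV ?gt_eqF// scale1r.
by rewrite sT.
Qed.

(* [k T - T^2] is the product of [T] and [k - T], and [k] times it is
   [(k - T) T (k - T) + T (k - T) T]. *)
Lemma positive_sqr_le T k : symop T -> (forall f, cpos (ip (T f) f)) -> 0 < k ->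
  (forall f, ip (T f) f <=* k%:C *: ip f f) ->
  forall f, ip (T f) (T f) <=* k%:C *: ip (T f) f.
Proof.
move=> sT Tp k0 Tk f; pose g : H := k%:C *: f - T f.
have kV : k^-1%:C * k%:C = 1 by rewrite -rmorphM mulVf ?gt_eqF.
rewrite /cle (_ : _ - _ = k^-1%:C *:
    (ip (T g) g + (k%:C *: ip (T f) (T f) - ip (T (T f)) (T f)))).
  by apply: cposZ; [rewrite invr_ge0 ltW | apply: cposD => //; exact: Tk].
rewrite -[LHS]scale1r -kV -scalerA; congr (_ *: _).
have -> : k%:C *: ip (T f) (T f) - ip (T (T f)) (T f) = ip (T g) (T f).
  by rewrite /g symopB// symopZ// ipBl ipZl.
rewrite [in RHS]/g ipBr subrK ipZrr; congr (_ *: _).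
by rewrite /g symopB// symopZ// ipBl ipZl (sT (T f)).
Qed.

Lemma symop_inverse T (T' : H -> H) :
  symop T -> cancel T' T -> symop T'.
Proof. by move=> sT TK f g; rewrite -{2}(TK f) sT TK. Qed.

Lemma GLplus_sqrt (C : {linear H -> H}) : GLplus C ->
  exists (E : H -> H) (m M : R), [/\ symop E, forall f, E (E f) = C f, 0 < m,
    forall f, m%:C *: ip f f <=* ip (E f) (E f) /\
              ip (E f) (E f) <=* M%:C *: ip f f &
    forall Z, symop Z -> (forall f, Z (C f) = C (Z f)) ->
      forall f, Z (E f) = E (Z f)].
Proof.
move=> [Cp [M0 CM] [C' [CK C'K [M1 CM']]]].
have sC : symop C := positive_symop Cp.
have sC' := symop_inverse sC C'K.
have real_bound (T : H -> H) M : (forall f, `|T f| <= M%:C * `|f|) ->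
    forall f, nrm (T f) <= M * nrm f.
  by move=> TM f; rewrite -lecR rmorphM /= -!normE.
move/real_bound in CM; move/real_bound in CM'.
(* [k] exceeds the bound of [C] and [k'] that of [C'^2], where [C'] is the inverse of [C]; [k >= 2]
   and [k' >= 1] ensure [m / k < 1]. *)
pose k := `|M0| + 2; pose k' := M1 ^+ 2 + 1.
have k2 : 2 <= k by rewrite lerDr.
have k0 : 0 < k by lra.
have k'1 : 1 <= k' by rewrite lerDr sqr_ge0.
have k'0 : 0 < k' by lra.
have Ck f : ip (C f) f <=* k%:C *: ip f f.
  apply: symop_le sC CM _ k0 f; rewrite /k; have := ler_norm M0; lra.
have C'k g : ip (C' (C' g)) g <=* k'%:C *: ip g g.
  apply: (@symop_le (fun g => C' (C' g)) (`|M1| ^+ 2)) => //.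
  - by move=> f h; rewrite !sC'.
  - have CM1 h : nrm (C' h) <= `|M1| * nrm h.
      by rewrite (le_trans (CM' h))// ler_wpM2r ?nrm_ge0// ler_norm.
    by move=> h; rewrite (le_trans (CM1 _))// expr2 -mulrA ler_wpM2l.
  by rewrite real_normK ?num_real// /k' ltrDl.
pose m := (k' * k)^-1.
have m0 : 0 < m by rewrite invr_gt0 mulr_gt0.
(* [<f, f> = <C'^2 C f, C f> <= k' <C f, C f> <= k' k <C f, f>]. *)
have mC f : m%:C *: ip f f <=* ip (C f) f.
  have h : ip f f <=* (k' * k)%:C *: ip (C f) f.
    apply: (@cle_trans _ _ (k'%:C *: ip (C f) (C f))).
      by have := C'k (C f); rewrite sC' !CK.
    rewrite rmorphM -scalerA; apply: cleZ; first exact: ltW.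
    exact: positive_sqr_le.
  have := cleZ (ltW m0) h; rewrite [X in _ <=* X]scalerA -rmorphM.
  by rewrite mulVf ?scale1r// gt_eqF ?mulr_gt0.
have mk : m / k < 1.
  rewrite ltr_pdivrMr// mul1r; apply: (@lt_trans _ _ 1); last by lra.
  by rewrite invf_lt1 ?mulr_gt0//; nra.
pose X f : H := f - k^-1%:C *: C f.
have sX : symop X by move=> f g; rewrite /X ipBl ipBr ipZl ipZrr sC.
have kK : k%:C * k^-1%:C = 1 by rewrite -rmorphM mulfV ?gt_eqF.
have Xp f : cpos (ip (X f) f).
  rewrite (_ : ip _ _ = k^-1%:C *: (k%:C *: ip f f - ip (C f) f)).
    by apply: cposZ (Ck f); rewrite invr_ge0 ltW.
  by rewrite ipBl ipZl scalerBr scalerA mulrC kK scale1r.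
pose c := 1 - m / k.
have c0 : 0 < c by rewrite subr_gt0.
have c1 : c < 1 by rewrite ltrBlDr ltrDl divr_gt0.
have Xc f : ip (X f) f <=* c%:C *: ip f f.
  rewrite /cle (_ : _ - _ = k^-1%:C *: (ip (C f) f - m%:C *: ip f f)).
    by apply: cposZ (mC f); rewrite invr_ge0 ltW.
  rewrite ipBl ipZl /c rmorphB /= scalerBl scale1r opprB scalerBr.
  by rewrite addrC subrKA scalerA -rmorphM mulrC.
(* The form bounds [0 <= X <= c] become a norm bound through [X^2 <= c X <= c^2] and monotonicity of
   the norm. *)
have Xn f : nrm (X f) <= c * nrm f.
  have : ip (X f) (X f) <=* (c ^+ 2)%:C *: ip f f.
    apply: cle_trans (positive_sqr_le sX Xp c0 Xc f) _.
    by rewrite expr2 rmorphM -scalerA; apply: cleZ (ltW c0) (Xc f).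
  move/(cle_nrm (ip_ge0 _)); rewrite nrmZ nrmC !nrm_ip ger0_norm ?sqr_ge0//.
  by rewrite -exprMn ler_pXn2r ?nnegrE ?mulr_ge0 ?nrm_ge0 ?(ltW c0).
have [S [sS SS SZ]] := sqrt_one_sub sX (ltW c0) c1 Xn.
pose E f : H := (Num.sqrt k)%:C *: S f.
have sE : symop E by move=> f g; rewrite ipZl ipZrr sS.
have EE f : E (E f) = C f.
  rewrite /E symopZ// scalerA -rmorphM -expr2 sqr_sqrtr ?(ltW k0)// SS.
  by rewrite opprB addrC subrK scalerA kK scale1r.
exists E, m, k; split => //.
  by move=> f; rewrite sE EE -sC; split.
move=> Z sZ ZC f; rewrite symopZ// SZ// => g.
by rewrite /X symopB// symopZ// ZC.
Qed.

End PositiveOperators.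

(** * Transfer of the frame bounds to the controlled sum *)

Lemma adjoint_symop (R : realType) (A : cstarAlgType R) (E F : hilbertModType A)
  (T : adjointable E F) : symop (fun f => adjoint T (T f)).
Proof. by move=> f g; rewrite -adjP ip_star -adjP -ip_star. Qed.

Theorem proposition3p3 (R : realType) (A : cstarAlgType R)
    (H : hilbertModType A) (J : choiceType) (S : J -> closedSubmod H)
    (L : forall j : J, adjointable H (submod (S j)))
    (C C' : {linear H -> H}) :
  is_gframe L ->
  GLplus C -> GLplus C' ->
  (forall f : H, C (C' f) = C' (C f)) ->
  (forall (j : J) (f : H), C (adjoint (L j) (L j f)) = adjoint (L j) (L j (C f))) ->
  (forall (j : J) (f : H), C' (adjoint (L j) (L j f)) = adjoint (L j) (L j (C' f))) ->
  is_controlled_gframe L C C'.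
Proof.
move=> [a [b [a0 b0 frame]]] GC GC' CC' CL C'L.
have [E [m [M [sE EE m0 Eb EZ]]]] := GLplus_sqrt GC.
have [E' [m' [M' [sE' EE' m'0 E'b E'Z]]]] := GLplus_sqrt GC'.
have sC' : symop C' := positive_symop (let: And3 p _ _ := GC' in p).
(* [C'] commutes with [C], hence with [E]; then [E], commuting with [C'], commutes with [E']. *)
have E'E f : E (E' f) = E' (E f).
  by apply: E'Z => // g; rewrite -EZ.
have sP j := adjoint_symop (L j).
have EP j f : E (adjoint (L j) (L j f)) = adjoint (L j) (L j (E f)).
  by rewrite (EZ _ (sP j)).
have E'P j f : E' (adjoint (L j) (L j f)) = adjoint (L j) (L j (E' f)).
  by rewrite (E'Z _ (sP j)).
pose D f := E (E' f).
(* With every factor moved to the right of [<f, _>], both sides contain [E] and [E'] twice and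
   [L_j^* L_j] once, and these commute. *)
have key j f : ip (L j (C f)) (L j (C' f)) = ip (L j (D f)) (L j (D f)).
  rewrite !adjP -EE -EE' /D !sE sE'; congr (ip f _).
  by rewrite !EP !E'P !E'E.
have Dge f : (m * m')%:C *: ip f f <=* ip (D f) (D f).
  apply: cle_trans (Eb (E' f)).1; rewrite rmorphM -scalerA.
  by apply: cleZ (E'b f).1; exact: ltW.
have Dle f : ip (D f) (D f) <=* (`|M| * M')%:C *: ip f f.
  apply: (@cle_trans _ _ (`|M|%:C *: ip (E' f) (E' f))).
    apply: cle_trans (Eb (E' f)).2 _; rewrite /cle -scalerBl -rmorphB.
    by apply: cposZ (ip_ge0 _); rewrite subr_ge0 ler_norm.
  by rewrite rmorphM -scalerA; exact: cleZ (normr_ge0 M) (E'b f).2.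
(* The maximum secures [lo <= hi], which the inequalities on the module cannot give when the module
   is zero. *)
pose lo := a * (m * m'); pose hi := Num.max lo (b * (`|M| * M')).
exists lo, hi; split; [by rewrite !mulr_gt0|by rewrite le_max lexx|] => f.
have [s [sums as_ sb]] := frame (D f); exists s; split.
- by under eq_fun do rewrite key.
- apply: cle_trans as_; rewrite rmorphM -scalerA.
  by apply: cleZ (Dge f); exact: ltW.
apply: cle_trans sb _; apply: (@cle_trans _ _ ((b * (`|M| * M'))%:C *: ip f f)).
  by rewrite rmorphM -scalerA; apply: cleZ (Dle f); exact: ltW.
rewrite /cle -scalerBl -rmorphB; apply: cposZ (ip_ge0 _).
by rewrite subr_ge0 le_max lexx orbT.
Qed.
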